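(* Let $\mathbb{H}_4$ be the Sweedler Hopf algebra over $\mathbb{R}$ with basis $1,g,\nu,g\nu$, and let $\mathbb{H}_{s}$ be the split quaternion algebra over $\mathbb{R}$ with basis $1,e_1,e_2,e_3$. Let $l_1,l_2,l_3,l_4\in\mathbb{R}$ be arbitrary parameters. Define a linear map $\cdot:\mathbb{H}_4\otimes\mathbb{H}_{s}\to\mathbb{H}_{s}$ on basis elements by: - $1\cdot 1=1$, $1\cdot e_i=e_i$ for $i=1,2,3$; - $g\cdot 1=g\cdot e_1=g\cdot e_2=g\cdot e_3=0$; - $\nu\cdot 1=e_3$, $\nu\cdot e_1=e_2$, $\nu\cdot e_2=e_1$, $\nu\cdot e_3=1$; - $g\nu\cdot 1=l_1 1-l_2e_1+l_3e_2+l_4e_3$, $g\nu\cdot e_1=l_2 1+l_1e_1-l_4e_2+l_3e_3$, $g\nu\cdot e_2=l_3 1-l_4e_1+l_1e_2+l_2e_3$, $g\nu\cdot e_3=l_4 1+l_3e_1-l_2e_2+l_1e_3$. Define a linear map $\omega:\mathbb{H}_4\otimes\mathbb{H}_4\to\mathbb{H}_{s}$, writing $\omega(h,l)=\omega(h\otimes l)$, on basis elements by: - $\omega(1,1)=1$, $\omega(1,g)=0$, $\omega(1,\nu)=e_3$, $\omega(1,g\nu)=l_1 1-l_2e_1+l_3e_2+l_4e_3$; - $\omega(g,1)=\omega(g,g)=\omega(g,\nu)=\omega(g,g\nu)=0$; - $\omega(\nu,1)=e_3$, $\omega(\nu,g)=0$, $\omega(\nu,\nu)=1$, $\omega(\nu,g\nu)=l_4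 1+l_3e_1-l_2e_2+l_1e_3$; - $\omega(g\nu,1)=l_1 1-l_2e_1+l_3e_2+l_4e_3$, $\omega(g\nu,g)=\omega(g\nu,g\nu)=0$, $\omega(g\nu,\nu)=l_4 1+l_3e_1-l_2e_2+l_1e_3$. Then the pair $(\cdot,\omega)$ is a twisted partial action of $\mathbb{H}_4$ on $\mathbb{H}_{s}$.
   Context: All algebras, tensor products and linear maps are over $\mathbb{R}$. Sweedler notation $\Delta(h)=h_1\otimes h_2$ (summation suppressed) is used. Sweedler Hopf algebra $\mathbb{H}_4$: generated by $g,\nu$ with $g^2=1$, $\nu^2=0$, $g\nu+\nu g=0$; $\Delta(g)=g\otimes g$, $\Delta(\nu)=g\otimes\nu+\nu\otimes 1$, $\varepsilon(g)=1$, $\varepsilon(\nu)=0$, $S(g)=g$, $S(\nu)=-g\nu$. It is $4$-dimensional with basis $1,g,\nu,g\nu$. Split quaternion algebra $\mathbb{H}_{s}$: the unital associative $\mathbb{R}$-algebra with basis $1,e_1,e_2,e_3$ and $e_1^2=-1$, $e_2^2=1$, $e_3^2=1$, $e_1e_2=e_3=-e_2e_1$, $e_2e_3=-e_1=-e_3e_2$, $e_3e_1=e_2=-e_1e_3$. Twisted partial action: let $H$ be a Hopf algebra and $A$ a unital algebra with unit $1_A$. A pair of linear maps $\cdot:H\otimes A\to A$ and $\omega:H\otimes H\to A$ (with $\omega(h,l)=\omega(h\otimes l)$) is a twisted partial action of $H$ on $A$ if for all $a,b\in A$ and $h,l\in H$: (1) $1_H\cdot a=a$; (2) $h\cdot(ab)=(h_1\cdot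 a)(h_2\cdot b)$; (3) $(h_1\cdot(l_1\cdot a))\,\omega(h_2,l_2)=\omega(h_1,l_1)\,(h_2l_2\cdot a)$; (4) $\omega(h,l)=\omega(h_1,l_1)\,(h_2l_2\cdot 1_A)$. *)

(* Defs.v *)
From HB Require Import structures.
From mathcomp Require Import all_boot all_order all_algebra.
From mathcomp Require boolp.
From mathcomp Require Import sesquilinear.
From mathcomp Require Import ring.

Set Implicit Arguments.
Unset Strict Implicit.
Unset Printing Implicit Defensive.

Import GRing.Theory.
Local Open Scope ring_scope.

(* An element of U (x) V is represented by a list of pairs, (u, v) standing   *)
(* for the pure tensor u (x) v and the list for their sum.  By the universal  *)
(* property of the tensor product, two lists represent the same tensor iff    *)
(* every bilinear map takes the same value on them.  A linear map out of      *)
(* U (x) V is a {bilinear U -> V -> W}, and a Sweedler sum                     *)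
(* B(h_1, h_2) is \sum_(p <- comul h) B p.1 p.2.                              *)
Section Tensors.
Variable K : fieldType.

Definition tensor_eq (U V : lmodType K) (s t : seq (U * V)) : Prop :=
  forall (W : lmodType K) (B : {bilinear U -> V -> W}),
    \sum_(p <- s) B p.1 p.2 = \sum_(p <- t) B p.1 p.2.

Definition trilinear (U V W X : lmodType K) (T : U -> V -> W -> X) : Prop :=
  [/\ forall v w, linear (fun u => T u v w),
      forall u w, linear (fun v => T u v w) &
      forall u v, linear (T u v)].

Definition tensor3_eq (U V W : lmodType K) (s t : seq (U * V * W)) : Prop :=
  forall (X : lmodType K) (T : U -> V -> W -> X), trilinear T ->
    \sum_(p <- s) T p.1.1 p.1.2 p.2 = \sum_(p <- t) T p.1.1 p.1.2 p.2.

End Tensors.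

HB.mixin Record isHopfAlgebra (K : fieldType) H of GRing.Algebra K H := {
  comul : H -> seq (H * H);
  counit : H -> K;
  antipode : H -> H;
  comul_linear : forall (a : K) (x y : H),
    tensor_eq (comul (a *: x + y))
              ([seq (a *: p.1, p.2) | p <- comul x] ++ comul y);
  comul1 : tensor_eq (comul 1) [:: (1, 1)];
  comulM : forall x y : H,
    tensor_eq (comul (x * y))
              [seq (p.1 * q.1, p.2 * q.2) | p <- comul x, q <- comul y];
  comulA : forall x : H,
    tensor3_eq [seq (q.1, q.2, p.2) | p <- comul x, q <- comul p.1]
               [seq (p.1, q.1, q.2) | p <- comul x, q <- comul p.2];
  counit_linear : scalar counit;
  counit1 : counit 1 = 1;
  counitM : {morph counit : x y / x * y};
  counitl : forall x : H, \sum_(p <- comul x) counit p.1 *: p.2 = x;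
  counitr : forall x : H, \sum_(p <- comul x) counit p.2 *: p.1 = x;
  antipode_linear : linear antipode;
  antipodel : forall x : H,
    \sum_(p <- comul x) antipode p.1 * p.2 = (counit x)%:A;
  antipoder : forall x : H,
    \sum_(p <- comul x) p.1 * antipode p.2 = (counit x)%:A
}.

#[short(type="hopfAlgType")]
HB.structure Definition HopfAlgebra (K : fieldType) :=
  {H of GRing.Algebra K H & isHopfAlgebra K H}.

Definition twisted_partial_action (K : fieldType) (H : hopfAlgType K)
    (A : algType K) (act : {bilinear H -> A -> A})
    (omega : {bilinear H -> H -> A}) : Prop :=
  [/\ forall a : A, act 1 a = a,
      forall (h : H) (a b : A),
        act h (a * b) = \sum_(p <- comul h) act p.1 a * act p.2 b,
      forall (h l : H) (a : A),
        \sum_(p <- comul h) \sum_(q <- comul l)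
           act p.1 (act q.1 a) * omega p.2 q.2
        = \sum_(p <- comul h) \sum_(q <- comul l)
           omega p.1 q.1 * act (p.2 * q.2) a &
      forall h l : H,
        omega h l = \sum_(p <- comul h) \sum_(q <- comul l)
           omega p.1 q.1 * act (p.2 * q.2) 1].

(* Vectors with four coordinates, and the (bi)linear extension of a map given *)
(* by the table of its values on the standard basis.                          *)
Section Tables.
Variable K : fieldType.

Definition vec4 (a b c d : K) : 'rV[K]_4 := \row_j [:: a; b; c; d]`_j.

Definition lin_ext (V : lmodType K) (T : seq V) (x : 'rV[K]_4) : V :=
  \sum_(i < 4) x 0 i *: T`_i.

Definition bilin_ext (V : lmodType K) (T : seq (seq V)) (x y : 'rV[K]_4) : V :=
  \sum_(i < 4) \sum_(j < 4) (x 0 i * y 0 j) *: (nth [::] T i)`_j.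

Lemma lin_ext_is_linear (V : lmodType K) (T : seq V) : linear (lin_ext T).
Proof.
move=> a x y; rewrite /lin_ext scaler_sumr -big_split /=.
by apply: eq_bigr => i _; rewrite !mxE scalerDl scalerA.
Qed.

Lemma bilin_ext_is_bilinear (V : lmodType K) (T : seq (seq V)) :
  bilinear_for *:%R *:%R (bilin_ext T).
Proof.
split=> u a x y /=; rewrite /bilin_ext scaler_sumr -big_split /=;
  apply: eq_bigr => i _; rewrite scaler_sumr -big_split /=;
  apply: eq_bigr => j _; rewrite !mxE scalerA -scalerDl; congr (_ *: _); ring.
Qed.

Lemma ord4P (P : 'I_4 -> Prop) :
  P (@Ordinal 4 0 isT) -> P (@Ordinal 4 1 isT) ->
  P (@Ordinal 4 2 isT) -> P (@Ordinal 4 3 isT) -> forall i, P i.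
Proof.
move=> P0 P1 P2 P3 [[|[|[|[|//]]]] lti];
  by rewrite (bool_irrelevance lti isT).
Qed.

Lemma sum4E (V : nmodType) (F : 'I_4 -> V) :
  \sum_(i < 4) F i = F (@Ordinal 4 0 isT) + F (@Ordinal 4 1 isT)
                   + F (@Ordinal 4 2 isT) + F (@Ordinal 4 3 isT).
Proof.
rewrite !big_ord_recl big_ord0 addr0 /= !addrA.
by congr (F _ + F _ + F _ + F _); apply: val_inj.
Qed.

Lemma inord4E : (inord 0 = @Ordinal 4 0 isT) * (inord 1 = @Ordinal 4 1 isT)
  * (inord 2 = @Ordinal 4 2 isT) * (inord 3 = @Ordinal 4 3 isT).
Proof. by do !split; apply: val_inj; rewrite /= inordK. Qed.

Lemma row4_sum (x : 'rV[K]_4) : x = \sum_i x 0 i *: delta_mx 0 i.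
Proof. exact: row_sum_delta. Qed.

Lemma linear_coord (V : lmodType K) (f : 'rV[K]_4 -> V) : linear f ->
  forall x, f x = \sum_i x 0 i *: f (delta_mx 0 i).
Proof.
move=> fL x; pose g := HB.pack_for {linear 'rV[K]_4 -> V} f
  (GRing.isLinear.Build _ _ _ _ f fL).
rewrite -[f]/(g : _ -> _) {1}(row4_sum x) linear_sum.
by apply: eq_bigr => i _; rewrite linearZ.
Qed.

Lemma tensor_eq_coord (s t : seq ('rV[K]_4 * 'rV[K]_4)) :
  (forall i j, \sum_(p <- s) p.1 0 i * p.2 0 j
             = \sum_(p <- t) p.1 0 i * p.2 0 j) -> tensor_eq s t.
Proof.
move=> st W B.
have BE r : \sum_(p <- r) B p.1 p.2
    = \sum_i \sum_j (\sum_(p <- r) p.1 0 i * p.2 0 j)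
                    *: B (delta_mx 0 i) (delta_mx 0 j).
  under [RHS]eq_bigr do under eq_bigr do rewrite scaler_suml.
  under [RHS]eq_bigr do rewrite exchange_big /=.
  rewrite exchange_big /=; apply: eq_bigr => p _.
  rewrite {1}(row4_sum p.1) linear_sumlz; apply: eq_bigr => i _.
  rewrite linearZl_LR {1}(row4_sum p.2) linear_sumr scaler_sumr.
  by apply: eq_bigr => j _; rewrite linearZr_LR scalerA.
by rewrite !BE; apply: eq_bigr => i _; apply: eq_bigr => j _; rewrite st.
Qed.

Lemma tensor3_eq_coord (s t : seq ('rV[K]_4 * 'rV[K]_4 * 'rV[K]_4)) :
  (forall i j k, \sum_(p <- s) p.1.1 0 i * p.1.2 0 j * p.2 0 k
               = \sum_(p <- t) p.1.1 0 i * p.1.2 0 j * p.2 0 k) ->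
  tensor3_eq s t.
Proof.
move=> st W T [T1 T2 T3].
have TE r : \sum_(p <- r) T p.1.1 p.1.2 p.2
    = \sum_i \sum_j \sum_k (\sum_(p <- r) p.1.1 0 i * p.1.2 0 j * p.2 0 k)
        *: T (delta_mx 0 i) (delta_mx 0 j) (delta_mx 0 k).
  under [RHS]eq_bigr do under eq_bigr do under eq_bigr do rewrite scaler_suml.
  under [RHS]eq_bigr do under eq_bigr do rewrite exchange_big /=.
  under [RHS]eq_bigr do rewrite exchange_big /=.
  rewrite exchange_big /=; apply: eq_bigr => p _.
  rewrite (linear_coord (T1 _ _)); apply: eq_bigr => i _.
  rewrite (linear_coord (T2 _ _)) scaler_sumr; apply: eq_bigr => j _.
  rewrite (linear_coord (T3 _ _)) !scaler_sumr; apply: eq_bigr => k _.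
  by rewrite !scalerA.
rewrite !TE; apply: eq_bigr => i _; apply: eq_bigr => j _.
by apply: eq_bigr => k _; rewrite st.
Qed.

Lemma vec4_delta : (vec4 1 0 0 0 = delta_mx 0 (@Ordinal 4 0 isT))
  * (vec4 0 1 0 0 = delta_mx 0 (@Ordinal 4 1 isT))
  * (vec4 0 0 1 0 = delta_mx 0 (@Ordinal 4 2 isT))
  * (vec4 0 0 0 1 = delta_mx 0 (@Ordinal 4 3 isT)).
Proof. by do !split; apply/rowP; apply: ord4P; rewrite !mxE. Qed.

Lemma lin_ext_delta (V : lmodType K) (T : seq V) (i : 'I_4) :
  lin_ext T (delta_mx 0 i) = T`_i.
Proof.
rewrite /lin_ext (bigD1 i) //= big1 ?addr0 => [|k /negPf ki].
  by rewrite mxE !eqxx scale1r.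
by rewrite mxE ki andbF scale0r.
Qed.

Lemma bilin_ext_delta (V : lmodType K) (T : seq (seq V)) (i j : 'I_4) :
  bilin_ext T (delta_mx 0 i) (delta_mx 0 j) = (nth [::] T i)`_j.
Proof.
rewrite -[RHS]lin_ext_delta /lin_ext /bilin_ext (bigD1 i) //= [X in _ + X]big1 ?addr0.
  by apply: eq_bigr => k _; rewrite !mxE !eqxx mul1r.
move=> k /negPf ki; rewrite big1 // => m _.
by rewrite !mxE ki andbF mul0r scale0r.
Qed.

End Tables.

HB.instance Definition _ (K : fieldType) (V : lmodType K) (T : seq (seq V)) :=
  bilinear_isBilinear.Build K 'rV[K]_4 'rV[K]_4 V *:%R *:%R (bilin_ext T)
    (bilin_ext_is_bilinear T).

(* Coordinates are taken in the ordered basis 1, g, nu, g nu.                 *)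
Definition sweedler (K : fieldType) : Type := 'rV[K]_4.
HB.instance Definition _ (K : fieldType) := Vector.on (sweedler K).

Section Sweedler.
Variable K : fieldType.

Definition sw_one : sweedler K := vec4 1 0 0 0.
Definition sw_g : sweedler K := vec4 0 1 0 0.
Definition sw_nu : sweedler K := vec4 0 0 1 0.
Definition sw_gnu : sweedler K := vec4 0 0 0 1.

Definition sw_mul : sweedler K -> sweedler K -> sweedler K :=
  bilin_ext [:: [:: sw_one; sw_g;    sw_nu;  sw_gnu];
                [:: sw_g;   sw_one;  sw_gnu; sw_nu];
                [:: sw_nu;  - sw_gnu; 0;     0];
                [:: sw_gnu; - sw_nu;  0;     0]].

Lemma sw_mulE x y : sw_mul x y =
  let x_ k := x 0 (inord k) in let y_ k := y 0 (inord k) in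
  vec4 (x_ 0 * y_ 0 + x_ 1 * y_ 1)
       (x_ 0 * y_ 1 + x_ 1 * y_ 0)
       (x_ 0 * y_ 2 + x_ 2 * y_ 0 + x_ 1 * y_ 3 - x_ 3 * y_ 1)
       (x_ 0 * y_ 3 + x_ 3 * y_ 0 + x_ 1 * y_ 2 - x_ 2 * y_ 1).
Proof.
rewrite /= !inord4E /sw_mul /bilin_ext !sum4E /=.
by apply/rowP; apply: ord4P; rewrite !mxE /=; ring.
Qed.

Lemma sw_mulA : associative sw_mul.
Proof.
move=> x y z; rewrite !sw_mulE /= !inord4E.
by apply/rowP; apply: ord4P; rewrite !mxE /=; ring.
Qed.

Lemma sw_mul1r : left_id sw_one sw_mul.
Proof.
move=> x; rewrite !sw_mulE /= !inord4E.
by apply/rowP; apply: ord4P; rewrite !mxE /=; ring.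
Qed.

Lemma sw_mulr1 : right_id sw_one sw_mul.
Proof.
move=> x; rewrite !sw_mulE /= !inord4E.
by apply/rowP; apply: ord4P; rewrite !mxE /=; ring.
Qed.

Lemma sw_mulDl : left_distributive sw_mul +%R.
Proof. by move=> x y z; rewrite /sw_mul linearDl. Qed.

Lemma sw_mulDr : right_distributive sw_mul +%R.
Proof. by move=> x y z; rewrite /sw_mul linearDr. Qed.

Lemma sw_one_neq0 : sw_one != 0.
Proof.
apply/eqP=> /rowP/(_ (@Ordinal 4 0 isT)); rewrite !mxE /= => /eqP.
by rewrite oner_eq0.
Qed.

HB.instance Definition _ := GRing.Zmodule_isNzRing.Build (sweedler K)
  sw_mulA sw_mul1r sw_mulr1 sw_mulDl sw_mulDr sw_one_neq0.

Lemma sw_scalerAl (a : K) (x y : sweedler K) : a *: (x * y) = (a *: x) * y.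
Proof. exact/esym/linearZl_LR. Qed.

HB.instance Definition _ :=
  GRing.Lmodule_isLalgebra.Build K (sweedler K) sw_scalerAl.

Lemma sw_scalerAr (a : K) (x y : sweedler K) : a *: (x * y) = x * (a *: y).
Proof. exact/esym/linearZr_LR. Qed.

HB.instance Definition _ :=
  GRing.Lalgebra_isAlgebra.Build K (sweedler K) sw_scalerAr.

Definition sw_comul (x : sweedler K) : seq (sweedler K * sweedler K) :=
  [seq (x 0 i *: p.1, p.2) | i : 'I_4 <- enum 'I_4,
     p <- nth [::] [:: [:: (sw_one, sw_one)];
                       [:: (sw_g, sw_g)];
                       [:: (sw_g, sw_nu); (sw_nu, sw_one)];
                       [:: (sw_one, sw_gnu); (sw_gnu, sw_g)]] i].

Definition sw_counit : sweedler K -> K := lin_ext ([:: 1; 1; 0; 0] : seq K^o).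

Definition sw_antipode : sweedler K -> sweedler K :=
  lin_ext [:: sw_one; sw_g; - sw_gnu; sw_nu].

Lemma sw_comulE (V : nmodType) (F : sweedler K * sweedler K -> V) x :
  \sum_(p <- sw_comul x) F p =
    F (x 0 (@Ordinal 4 0 isT) *: sw_one, sw_one)
    + F (x 0 (@Ordinal 4 1 isT) *: sw_g, sw_g)
    + (F (x 0 (@Ordinal 4 2 isT) *: sw_g, sw_nu)
       + F (x 0 (@Ordinal 4 2 isT) *: sw_nu, sw_one))
    + (F (x 0 (@Ordinal 4 3 isT) *: sw_one, sw_gnu)
       + F (x 0 (@Ordinal 4 3 isT) *: sw_gnu, sw_g)).
Proof. by rewrite big_allpairs_dep big_enum sum4E /= !big_cons !big_nil !addr0. Qed.

Lemma sw_mul_basis : (sw_g * sw_g = sw_one) * (sw_g * sw_nu = sw_gnu)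
  * (sw_g * sw_gnu = sw_nu) * (sw_nu * sw_g = - sw_gnu) * (sw_nu * sw_nu = 0)
  * (sw_nu * sw_gnu = 0) * (sw_gnu * sw_g = - sw_nu) * (sw_gnu * sw_nu = 0)
  * (sw_gnu * sw_gnu = 0).
Proof.
by do !split; rewrite [LHS]sw_mulE /= !inord4E; apply/rowP; apply: ord4P;
  rewrite !mxE /=; ring.
Qed.

Let coordD (x y : sweedler K) i : (x + y) 0 i = x 0 i + y 0 i.
Proof. exact: mxE. Qed.
Let coordN (x : sweedler K) i : (- x) 0 i = - x 0 i.
Proof. exact: mxE. Qed.
Let coordZ a (x : sweedler K) i : (a *: x) 0 i = a * x 0 i.
Proof. exact: mxE. Qed.
Let coord0 i : (0 : sweedler K) 0 i = 0.
Proof. exact: mxE. Qed.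
Let coordE := (coordD, coordN, coordZ, coord0).

Let onel (x : sweedler K) : sw_one * x = x. Proof. exact: mul1r. Qed.
Let oner (x : sweedler K) : x * sw_one = x. Proof. exact: mulr1. Qed.
Let basisE := (sw_mul_basis, onel, oner).

Let coordM (x y : sweedler K) :
  ((x * y) 0 (@Ordinal 4 0 isT) = x 0 (@Ordinal 4 0 isT) * y 0 (@Ordinal 4 0 isT)
     + x 0 (@Ordinal 4 1 isT) * y 0 (@Ordinal 4 1 isT))
  * ((x * y) 0 (@Ordinal 4 1 isT) = x 0 (@Ordinal 4 0 isT) * y 0 (@Ordinal 4 1 isT)
     + x 0 (@Ordinal 4 1 isT) * y 0 (@Ordinal 4 0 isT))
  * ((x * y) 0 (@Ordinal 4 2 isT) = x 0 (@Ordinal 4 0 isT) * y 0 (@Ordinal 4 2 isT)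
     + x 0 (@Ordinal 4 2 isT) * y 0 (@Ordinal 4 0 isT)
     + x 0 (@Ordinal 4 1 isT) * y 0 (@Ordinal 4 3 isT)
     - x 0 (@Ordinal 4 3 isT) * y 0 (@Ordinal 4 1 isT))
  * ((x * y) 0 (@Ordinal 4 3 isT) = x 0 (@Ordinal 4 0 isT) * y 0 (@Ordinal 4 3 isT)
     + x 0 (@Ordinal 4 3 isT) * y 0 (@Ordinal 4 0 isT)
     + x 0 (@Ordinal 4 1 isT) * y 0 (@Ordinal 4 2 isT)
     - x 0 (@Ordinal 4 2 isT) * y 0 (@Ordinal 4 1 isT)).
Proof.
have -> : x * y = sw_mul x y by [].
by do !split; rewrite sw_mulE /= !inord4E mxE.
Qed.

(* The multiplication table is that of the algebra presented by generators    *)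
(* g, nu and relations g^2 = 1, nu^2 = 0, g nu + nu g = 0.                    *)
Lemma sw_relations : [/\ sw_g * sw_g = 1, sw_nu * sw_nu = 0 &
  sw_g * sw_nu + sw_nu * sw_g = 0].
Proof. by split; rewrite !basisE ?subrr. Qed.

Lemma sw_universal (A : algType K) (x y : A) :
    x * x = 1 -> y * y = 0 -> x * y + y * x = 0 ->
  exists! f : sweedler K -> A,
    [/\ linear f, f 1 = 1, {morph f : a b / a * b}, f sw_g = x & f sw_nu = y].
Proof.
move=> xx yy /eqP; rewrite addrC addr_eq0 => /eqP yx.
pose T := [:: 1; x; y; x * y]; pose f : sweedler K -> A := lin_ext T.
have fL : linear f by exact: lin_ext_is_linear.
have [f1 fg fn fgn] : [/\ f sw_one = 1, f sw_g = x, f sw_nu = y &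
    f sw_gnu = x * y].
  by split; rewrite /f /sw_one /sw_g /sw_nu /sw_gnu !vec4_delta lin_ext_delta.
have f0 : f 0 = 0 by have := fL (-1) 0 0; rewrite scaleN1r addNr scaleN1r addNr.
have fN u : f (- u) = - f u.
  by have := fL (-1) u 0; rewrite f0 !scaleN1r !addr0.
have fM : {morph f : a b / a * b}.
  move=> a b.
  have Ll c : linear (fun u => f (u * c)).
    by move=> k u v; rewrite mulrDl -scalerAl fL.
  have Lr c : linear (fun u => f (c * u)).
    by move=> k u v; rewrite mulrDr -scalerAr fL.
  rewrite [LHS](linear_coord (Ll b) a) [in RHS](linear_coord fL a) mulr_suml.
  apply: eq_bigr => i _; rewrite -scalerAl; congr (_ *: _).
  rewrite [LHS](linear_coord (Lr _) b) [in RHS](linear_coord fL b) mulr_sumr.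
  apply: eq_bigr => j _; rewrite -scalerAr; congr (_ *: _); move: i j.
  do 2![apply: ord4P]; rewrite -!vec4_delta -/sw_one -/sw_g -/sw_nu -/sw_gnu;
    rewrite ?basisE ?fN ?f0 ?f1 ?fg ?fn ?fgn ?mul1r ?mulr1 //.
  - by rewrite mulrA xx mul1r.
  - by rewrite mulrA yx mulNr -mulrA yy mulr0 oppr0.
  - by rewrite -mulrA yx mulrN mulrA xx mul1r.
  - by rewrite -mulrA yy mulr0.
  - by rewrite mulrA -[x * y * x]mulrA yx mulrN mulrA xx mul1r mulNr yy oppr0.
exists f; split=> // h [hL h1 hM hg hn]; apply: boolp.funext => u.
rewrite (linear_coord fL) (linear_coord hL); apply: eq_bigr => i _.
congr (_ *: _); move: i.
apply: ord4P; rewrite -!vec4_delta -/sw_one -/sw_g -/sw_nu -/sw_gnu.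
- by rewrite f1 -h1.
- by rewrite fg -hg.
- by rewrite fn -hn.
- have <- : sw_g * sw_nu = sw_gnu by rewrite basisE.
  by rewrite fM hM fg fn hg hn.
Qed.

Lemma sw_comul_linear (a : K) (x y : sweedler K) :
  tensor_eq (sw_comul (a *: x + y))
            ([seq (a *: p.1, p.2) | p <- sw_comul x] ++ sw_comul y).
Proof.
apply: tensor_eq_coord => i j; rewrite big_cat big_map !sw_comulE /=.
by rewrite !coordE; ring.
Qed.

Let basis_coord :
  (sw_one 0 (@Ordinal 4 0 isT) = 1)
  * (sw_one 0 (@Ordinal 4 1 isT) = 0)
  * (sw_one 0 (@Ordinal 4 2 isT) = 0)
  * (sw_one 0 (@Ordinal 4 3 isT) = 0)
  * (sw_g 0 (@Ordinal 4 0 isT) = 0)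
  * (sw_g 0 (@Ordinal 4 1 isT) = 1)
  * (sw_g 0 (@Ordinal 4 2 isT) = 0)
  * (sw_g 0 (@Ordinal 4 3 isT) = 0)
  * (sw_nu 0 (@Ordinal 4 0 isT) = 0)
  * (sw_nu 0 (@Ordinal 4 1 isT) = 0)
  * (sw_nu 0 (@Ordinal 4 2 isT) = 1)
  * (sw_nu 0 (@Ordinal 4 3 isT) = 0)
  * (sw_gnu 0 (@Ordinal 4 0 isT) = 0)
  * (sw_gnu 0 (@Ordinal 4 1 isT) = 0)
  * (sw_gnu 0 (@Ordinal 4 2 isT) = 0)
  * (sw_gnu 0 (@Ordinal 4 3 isT) = 1).
Proof. by do !split; rewrite mxE. Qed.

Lemma sw_comul1 : tensor_eq (sw_comul 1) [:: (1, 1)].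
Proof.
apply: tensor_eq_coord => i j; rewrite big_seq1 sw_comulE /= !coordE.
by have -> : 1 = sw_one by []; rewrite !basis_coord; ring.
Qed.

Lemma sw_comulM (x y : sweedler K) :
  tensor_eq (sw_comul (x * y))
            [seq (p.1 * q.1, p.2 * q.2) | p <- sw_comul x, q <- sw_comul y].
Proof.
apply: tensor_eq_coord => i j; rewrite [RHS]big_allpairs_dep !sw_comulE /= !coordM.
rewrite -!scalerAl -!scalerAr !basisE !coordE; ring.
Qed.

Lemma sw_comulA (x : sweedler K) :
  tensor3_eq [seq (q.1, q.2, p.2) | p <- sw_comul x, q <- sw_comul p.1]
             [seq (p.1, q.1, q.2) | p <- sw_comul x, q <- sw_comul p.2].
Proof.
apply: tensor3_eq_coord => i j k; rewrite big_allpairs_dep [RHS]big_allpairs_dep !sw_comulE /=.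
by rewrite !coordE !basis_coord; ring.
Qed.

Lemma sw_counitE x :
  sw_counit x = x 0 (@Ordinal 4 0 isT) + x 0 (@Ordinal 4 1 isT).
Proof. by rewrite /sw_counit /lin_ext sum4E /= /GRing.scale /=; ring. Qed.

Lemma sw_counit_linear : scalar sw_counit.
Proof. by move=> a x y; rewrite !sw_counitE !coordE; ring. Qed.

Lemma sw_counit1 : sw_counit 1 = 1.
Proof.
by rewrite sw_counitE; have -> : 1 = sw_one by []; rewrite !basis_coord; ring.
Qed.

Lemma sw_counitM : {morph sw_counit : x y / x * y}.
Proof. by move=> x y; rewrite !sw_counitE !coordM; ring. Qed.

Let sw_decomp (x : sweedler K) :
  x = x 0 (@Ordinal 4 0 isT) *: sw_one + x 0 (@Ordinal 4 1 isT) *: sw_g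
    + x 0 (@Ordinal 4 2 isT) *: sw_nu + x 0 (@Ordinal 4 3 isT) *: sw_gnu.
Proof.
by apply/rowP; apply: ord4P; rewrite !coordE !basis_coord; ring.
Qed.

Lemma sw_counitl (x : sweedler K) :
  \sum_(p <- sw_comul x) sw_counit p.1 *: p.2 = x.
Proof.
rewrite sw_comulE /= !sw_counitE !coordE !basis_coord.
by apply/rowP => i; rewrite [in RHS](sw_decomp x) !coordE; ring.
Qed.

Lemma sw_counitr (x : sweedler K) :
  \sum_(p <- sw_comul x) sw_counit p.2 *: p.1 = x.
Proof.
rewrite sw_comulE /= !sw_counitE !basis_coord.
by apply/rowP => i; rewrite [in RHS](sw_decomp x) !coordE; ring.
Qed.

Lemma sw_antipode_linear : linear sw_antipode.
Proof. exact: lin_ext_is_linear. Qed.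

Lemma sw_antipodeE (x : sweedler K) : sw_antipode x =
  x 0 (@Ordinal 4 0 isT) *: sw_one + x 0 (@Ordinal 4 1 isT) *: sw_g
  - x 0 (@Ordinal 4 2 isT) *: sw_gnu + x 0 (@Ordinal 4 3 isT) *: sw_nu.
Proof. by rewrite /sw_antipode /lin_ext sum4E /= scalerN. Qed.

Lemma sw_antipode_basis : (sw_antipode sw_one = sw_one)
  * (sw_antipode sw_g = sw_g) * (sw_antipode sw_nu = - (sw_g * sw_nu))
  * (sw_antipode sw_gnu = sw_nu).
Proof.
by do !split; rewrite sw_antipodeE !basis_coord ?basisE;
  apply/rowP => i; rewrite !coordE; ring.
Qed.

Let antipodeZ a x : sw_antipode (a *: x) = a *: sw_antipode x.
Proof. exact: (scalable_linear sw_antipode_linear). Qed.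

Lemma sw_antipodel (x : sweedler K) :
  \sum_(p <- sw_comul x) sw_antipode p.1 * p.2 = (sw_counit x)%:A.
Proof.
rewrite sw_comulE /= !antipodeZ !sw_antipode_basis sw_counitE -!scalerAl.
have -> : 1 = sw_one by [].
by apply/rowP => i; rewrite ?mulNr !basisE !coordE; ring.
Qed.

Lemma sw_antipoder (x : sweedler K) :
  \sum_(p <- sw_comul x) p.1 * sw_antipode p.2 = (sw_counit x)%:A.
Proof.
rewrite sw_comulE /= !sw_antipode_basis sw_counitE -!scalerAl.
have -> : 1 = sw_one by [].
by apply/rowP => i; rewrite ?mulrN !basisE !coordE; ring.
Qed.

HB.instance Definition _ := isHopfAlgebra.Build K (sweedler K)
  sw_comul_linear sw_comul1 sw_comulM sw_comulA
  sw_counit_linear sw_counit1 sw_counitM sw_counitl sw_counitr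
  sw_antipode_linear sw_antipodel sw_antipoder.

End Sweedler.

(* Coordinates are taken in the ordered basis 1, e1, e2, e3.                  *)
Definition split_quaternion (K : fieldType) : Type := 'rV[K]_4.
HB.instance Definition _ (K : fieldType) := Vector.on (split_quaternion K).

Section SplitQuaternion.
Variable K : fieldType.

Definition sq_one : split_quaternion K := vec4 1 0 0 0.
Definition sq_e1 : split_quaternion K := vec4 0 1 0 0.
Definition sq_e2 : split_quaternion K := vec4 0 0 1 0.
Definition sq_e3 : split_quaternion K := vec4 0 0 0 1.

Definition sq_mul :
    split_quaternion K -> split_quaternion K -> split_quaternion K :=
  bilin_ext [:: [:: sq_one; sq_e1;    sq_e2;   sq_e3];
                [:: sq_e1;  - sq_one; sq_e3;   - sq_e2];
                [:: sq_e2;  - sq_e3;  sq_one;  - sq_e1];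
                [:: sq_e3;  sq_e2;    sq_e1;   sq_one]].

Lemma sq_mulE x y : sq_mul x y =
  let x_ k := x 0 (inord k) in let y_ k := y 0 (inord k) in
  vec4 (x_ 0 * y_ 0 - x_ 1 * y_ 1 + x_ 2 * y_ 2 + x_ 3 * y_ 3)
       (x_ 0 * y_ 1 + x_ 1 * y_ 0 - x_ 2 * y_ 3 + x_ 3 * y_ 2)
       (x_ 0 * y_ 2 + x_ 2 * y_ 0 - x_ 1 * y_ 3 + x_ 3 * y_ 1)
       (x_ 0 * y_ 3 + x_ 3 * y_ 0 + x_ 1 * y_ 2 - x_ 2 * y_ 1).
Proof.
rewrite /= !inord4E /sq_mul /bilin_ext !sum4E /=.
by apply/rowP; apply: ord4P; rewrite !mxE /=; ring.
Qed.

Lemma sq_mulA : associative sq_mul.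
Proof.
move=> x y z; rewrite !sq_mulE /= !inord4E.
by apply/rowP; apply: ord4P; rewrite !mxE /=; ring.
Qed.

Lemma sq_mul1r : left_id sq_one sq_mul.
Proof.
move=> x; rewrite !sq_mulE /= !inord4E.
by apply/rowP; apply: ord4P; rewrite !mxE /=; ring.
Qed.

Lemma sq_mulr1 : right_id sq_one sq_mul.
Proof.
move=> x; rewrite !sq_mulE /= !inord4E.
by apply/rowP; apply: ord4P; rewrite !mxE /=; ring.
Qed.

Lemma sq_mulDl : left_distributive sq_mul +%R.
Proof. by move=> x y z; rewrite /sq_mul linearDl. Qed.

Lemma sq_mulDr : right_distributive sq_mul +%R.
Proof. by move=> x y z; rewrite /sq_mul linearDr. Qed.

Lemma sq_one_neq0 : sq_one != 0.
Proof.
apply/eqP=> /rowP/(_ (@Ordinal 4 0 isT)); rewrite !mxE /= => /eqP.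
by rewrite oner_eq0.
Qed.

HB.instance Definition _ := GRing.Zmodule_isNzRing.Build (split_quaternion K)
  sq_mulA sq_mul1r sq_mulr1 sq_mulDl sq_mulDr sq_one_neq0.

Lemma sq_scalerAl (a : K) (x y : split_quaternion K) :
  a *: (x * y) = (a *: x) * y.
Proof. exact/esym/linearZl_LR. Qed.

HB.instance Definition _ :=
  GRing.Lmodule_isLalgebra.Build K (split_quaternion K) sq_scalerAl.

Lemma sq_scalerAr (a : K) (x y : split_quaternion K) :
  a *: (x * y) = x * (a *: y).
Proof. exact/esym/linearZr_LR. Qed.

HB.instance Definition _ :=
  GRing.Lalgebra_isAlgebra.Build K (split_quaternion K) sq_scalerAr.

Lemma sq_mul_basis :
  (sq_e1 * sq_e1 = - 1) * (sq_e2 * sq_e2 = 1) * (sq_e3 * sq_e3 = 1)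
  * (sq_e1 * sq_e2 = sq_e3) * (sq_e2 * sq_e1 = - sq_e3)
  * (sq_e2 * sq_e3 = - sq_e1) * (sq_e3 * sq_e2 = sq_e1)
  * (sq_e3 * sq_e1 = sq_e2) * (sq_e1 * sq_e3 = - sq_e2).
Proof.
by do !split; rewrite [LHS]sq_mulE /= !inord4E; apply/rowP; apply: ord4P;
  rewrite !mxE /=; ring.
Qed.

End SplitQuaternion.

Section ActionAndCocycle.
Variable K : fieldType.
Variables l1 l2 l3 l4 : K.

Local Notation H4 := (sweedler K).
Local Notation Hs := (split_quaternion K).
Local Notation e1 := (sq_e1 K).
Local Notation e2 := (sq_e2 K).
Local Notation e3 := (sq_e3 K).

(* Rows: the first argument runs over 1, g, nu, g nu; columns: the second     *)
(* argument runs over 1, e1, e2, e3 for the action, over 1, g, nu, g nu for   *)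
(* omega.                                                                     *)
Definition sw_act_table : seq (seq Hs) :=
  [:: [:: 1;  e1; e2; e3];
      [:: 0;  0;  0;  0];
      [:: e3; e2; e1; 1];
      [:: l1 *: 1 - l2 *: e1 + l3 *: e2 + l4 *: e3;
          l2 *: 1 + l1 *: e1 - l4 *: e2 + l3 *: e3;
          l3 *: 1 - l4 *: e1 + l1 *: e2 + l2 *: e3;
          l4 *: 1 + l3 *: e1 - l2 *: e2 + l1 *: e3]].

Definition sw_omega_table : seq (seq Hs) :=
  let u := l1 *: 1 - l2 *: e1 + l3 *: e2 + l4 *: e3 in
  let v := l4 *: 1 + l3 *: e1 - l2 *: e2 + l1 *: e3 in
  [:: [:: 1;  0; e3; u];
      [:: 0;  0; 0;  0];
      [:: e3; 0; 1;  v];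
      [:: u;  0; v;  0]].

Definition sw_act : H4 -> Hs -> Hs := bilin_ext sw_act_table.
Definition sw_omega : H4 -> H4 -> Hs := bilin_ext sw_omega_table.

HB.instance Definition _ :=
  bilinear_isBilinear.Build K H4 Hs Hs *:%R *:%R sw_act
    (bilin_ext_is_bilinear sw_act_table).
HB.instance Definition _ :=
  bilinear_isBilinear.Build K H4 H4 Hs *:%R *:%R sw_omega
    (bilin_ext_is_bilinear sw_omega_table).

End ActionAndCocycle.

(* Main.v *)
Require Import Defs.
From HB Require Import structures.
From mathcomp Require Import all_boot all_order all_algebra.
From mathcomp Require Import sesquilinear reals ring.

(** Put e = e3 and u = l1 - l2 e1 + l3 e2 + l4 e3.  Comparing entries shows
    that the action table is

      1 . a = a,   g . a = 0,   nu . a = e a,   (g nu) . a = a u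

    ([sw_act_two_sided]), and that omega(h, l) = h . (l . 1) on basis elements,
    except that omega(g nu, g nu) = 0 ([sw_omega_two_sided]).  On every algebra
    A, and for every e and u in A, these formulas define a twisted partial
    action ([two_sided_twisted_partial_action]).

    The reason is that g acts by zero, so the terms of a Sweedler sum with g in
    the first leg disappear and the comultiplication reduces to

      1 -> 1 (x) 1,   nu -> nu (x) 1,   g nu -> 1 (x) g nu + g nu (x) g

    ([sum_comul_kill_g]).  The term g nu (x) g survives only on the right-hand
    side of the cocycle condition, where g nu can enter omega while g enters
    the product h_2 l_2; elsewhere the second leg is killed by g as well.  So
    multiplicativity of the action reads e (a b) = (e a) b on nu and
    (a b) u = a (b u) on g nu.  In the cocycle condition both sides are equal
    to one explicit sum ([sum_act_omega], [sum_omega_act]) involving only a,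
    e a, a u, e e a and e a u: left multiplications by e commute with right
    multiplications by u.  The one cancellation takes place at h = l = g nu,
    where 1 (x) g nu against g nu (x) g, in both orders, gives
    u ((g nu g) . a) + u ((g g nu) . a) = - u (e a) + u (e a) = 0, matching
    omega(g nu, g nu) = 0.  At a = 1 the common value is omega(h, l), which is
    the last condition. *)

Set Implicit Arguments.
Unset Strict Implicit.
Unset Printing Implicit Defensive.

Import GRing.Theory.
Local Open Scope ring_scope.

Local Notation i0 := (@Ordinal 4 0 isT).
Local Notation i2 := (@Ordinal 4 2 isT).
Local Notation i3 := (@Ordinal 4 3 isT).
Local Notation g := (sw_g _).
Local Notation nu := (sw_nu _).
Local Notation gnu := (sw_gnu _).

(** Killing g removes the grouplike g and the first half of
    Delta(nu) = g (x) nu + nu (x) 1, but nothing from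
    Delta(g nu) = 1 (x) g nu + g nu (x) g. *)
Lemma sum_comul_kill_g (K : fieldType) (V : lmodType K)
    (F : sweedler K -> sweedler K -> V) (h : sweedler K) :
    (forall c x y, F (c *: x) y = c *: F x y) -> (forall y, F g y = 0) ->
  \sum_(p <- comul h) F p.1 p.2 =
    h 0 i0 *: F 1 1 + h 0 i2 *: F nu 1 + h 0 i3 *: (F 1 gnu + F gnu g).
Proof.
move=> FZ Fg; rewrite [LHS]sw_comulE /= !FZ !Fg !scaler0 addr0 add0r.
by rewrite scalerDr.
Qed.

Definition two_sided_action (K : fieldType) (A : algType K) (e u : A)
    (act : sweedler K -> A -> A) : Prop :=
  forall a, [/\ act 1 a = a, act g a = 0, act nu a = e * a & act gnu a = a * u].

(** On basis elements the value at (h, l) is h . (l . 1), except at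
    (g nu, g nu), where h . (l . 1) = u u is replaced by 0. *)
Definition two_sided_cocycle (K : fieldType) (A : algType K) (e u : A)
    (omega : sweedler K -> sweedler K -> A) : Prop :=
  omega =2 bilin_ext [:: [:: 1; 0; e;     u];
                         [:: 0; 0; 0;     0];
                         [:: e; 0; e * e; e * u];
                         [:: u; 0; e * u; 0]].

Section TwoSidedAction.

Variables (K : fieldType) (A : algType K) (e u : A).
Variable act : {bilinear sweedler K -> A -> A}.
Variable omega : {bilinear sweedler K -> sweedler K -> A}.
Hypothesis actP : two_sided_action e u act.
Hypothesis omegaP : two_sided_cocycle e u omega.

Let act1 a : act 1 a = a. Proof. by case: (actP a). Qed.
Let actg a : act g a = 0. Proof. by case: (actP a). Qed.
Let actnu a : act nu a = e * a. Proof. by case: (actP a). Qed.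
Let actgnu a : act gnu a = a * u. Proof. by case: (actP a). Qed.
Let actE := (act1, actg, actnu, actgnu).

Let omega_expand (h l : sweedler K) : omega h l =
    h 0 i0 *: (l 0 i0 *: 1 + l 0 i2 *: e + l 0 i3 *: u)
    + h 0 i2 *: (l 0 i0 *: e + l 0 i2 *: (e * e) + l 0 i3 *: (e * u))
    + h 0 i3 *: (l 0 i0 *: u + l 0 i2 *: (e * u)).
Proof.
by rewrite omegaP /bilin_ext !sum4E /= !scaler0 !addr0 !scalerDr !scalerA.
Qed.

Let omega_gl l : omega g l = 0.
Proof. by rewrite omega_expand !mxE /= !scale0r !addr0. Qed.

Let omega_gr h : omega h g = 0.
Proof. by rewrite omega_expand !mxE /= !scale0r !addr0 !scaler0 !addr0. Qed.

Let omega_basis : (omega 1 1 = 1) * (omega 1 nu = e) * (omega 1 gnu = u)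
  * (omega nu 1 = e) * (omega nu nu = e * e) * (omega nu gnu = e * u)
  * (omega gnu 1 = u) * (omega gnu nu = e * u) * (omega gnu gnu = 0).
Proof.
have -> : 1 = sw_one K by [].
by do !split; rewrite omegaP /sw_one /sw_g /sw_nu /sw_gnu !vec4_delta
  bilin_ext_delta.
Qed.
Let omegaE := (omega_basis, omega_gl, omega_gr).

Let act_expand (h : sweedler K) (a : A) :
  act h a = h 0 i0 *: a + h 0 i2 *: (e * a) + h 0 i3 *: (a * u).
Proof.
have act_linear : linear (act^~ a) by move=> c x y; rewrite linearPl.
rewrite (linear_coord act_linear) sum4E -!vec4_delta.
by rewrite -/(sw_one K) -/(sw_g K) -/(sw_nu K) -/(sw_gnu K) !actE scaler0 addr0.
Qed.

Lemma two_sided_action_mul (h : sweedler K) (a b : A) :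
  act h (a * b) = \sum_(p <- comul h) act p.1 a * act p.2 b.
Proof.
rewrite (sum_comul_kill_g (F := fun x y => act x a * act y b)).
- by rewrite act_expand !actE mulr0 addr0 !mulrA.
- by move=> c x y; rewrite linearZl_LR scalerAl.
- by move=> y; rewrite actg mul0r.
Qed.

(** The right-hand side of the cocycle condition; the value at a = 1 is
    omega(h, l). *)
Lemma sum_omega_act (h l : sweedler K) (a : A) :
  \sum_(p <- comul h) \sum_(q <- comul l) omega p.1 q.1 * act (p.2 * q.2) a =
    h 0 i0 *: (l 0 i0 *: a + l 0 i2 *: (e * a) + l 0 i3 *: (a * u))
    + h 0 i2 *: (l 0 i0 *: (e * a) + l 0 i2 *: (e * e * a)
                 + l 0 i3 *: (e * a * u))
    + h 0 i3 *: (l 0 i0 *: (a * u) + l 0 i2 *: (e * a * u)).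
Proof.
have inner x y : \sum_(q <- comul l) omega x q.1 * act (y * q.2) a =
    l 0 i0 *: (omega x 1 * act y a) + l 0 i2 *: (omega x nu * act y a)
    + l 0 i3 *: (omega x 1 * act (y * gnu) a + omega x gnu * act (y * g) a).
  rewrite (sum_comul_kill_g (F := fun q1 q2 => omega x q1 * act (y * q2) a)).
  - by rewrite mulr1.
  - by move=> c q1 q2; rewrite linearZr_LR scalerAl.
  - by move=> q2; rewrite omega_gr mul0r.
rewrite (sum_comul_kill_g (F := fun x y =>
  \sum_(q <- comul l) omega x q.1 * act (y * q.2) a)).
- rewrite !inner !mul1r !sw_mul_basis !omegaE !linearNl !linear0l !actE.
  rewrite !(mul1r, mulr0, mul0r, mulrN, addr0, scaler0, add0r, mulrA).
  (* The sides differ by the pair - u (e a) + u (e a) from h = l = g nu. *)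
  by rewrite scalerN subrK.
- move=> c x y; rewrite scaler_sumr; apply: eq_bigr => q _.
  by rewrite linearZl_LR scalerAl.
- by move=> y; rewrite big1 // => q _; rewrite omega_gl mul0r.
Qed.

Lemma sum_act_omega (h l : sweedler K) (a : A) :
  \sum_(p <- comul h) \sum_(q <- comul l)
     act p.1 (act q.1 a) * omega p.2 q.2 =
    h 0 i0 *: (l 0 i0 *: a + l 0 i2 *: (e * a) + l 0 i3 *: (a * u))
    + h 0 i2 *: (l 0 i0 *: (e * a) + l 0 i2 *: (e * e * a)
                 + l 0 i3 *: (e * a * u))
    + h 0 i3 *: (l 0 i0 *: (a * u) + l 0 i2 *: (e * a * u)).
Proof.
have inner x y : \sum_(q <- comul l) act x (act q.1 a) * omega y q.2 =
    l 0 i0 *: (act x a * omega y 1) + l 0 i2 *: (act x (e * a) * omega y 1)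
    + l 0 i3 *: (act x a * omega y gnu).
  rewrite (sum_comul_kill_g (F := fun q1 q2 => act x (act q1 a) * omega y q2)).
  - by rewrite !actE omega_gr mulr0 addr0.
  - by move=> c q1 q2; rewrite linearZl_LR linearZr_LR scalerAl.
  - by move=> q2; rewrite actg linear0r mul0r.
rewrite (sum_comul_kill_g (F := fun x y =>
  \sum_(q <- comul l) act x (act q.1 a) * omega y q.2)).
- by rewrite !inner !omegaE !actE !(mulr1, mulr0, addr0, scaler0, mulrA).
- move=> c x y; rewrite scaler_sumr; apply: eq_bigr => q _.
  by rewrite linearZl_LR scalerAl.
- by move=> y; rewrite big1 // => q _; rewrite actg mul0r.
Qed.

Lemma two_sided_twisted_partial_action : twisted_partial_action act omega.
Proof.
split=> [|h a b|h l a|h l]; first exact: act1.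
- exact: two_sided_action_mul.
- by rewrite sum_act_omega sum_omega_act.
- by rewrite sum_omega_act omega_expand !mul1r !mulr1.
Qed.

End TwoSidedAction.

Definition gnu_act_one (K : fieldType) (l1 l2 l3 l4 : K) : split_quaternion K :=
  l1 *: 1 - l2 *: sq_e1 K + l3 *: sq_e2 K + l4 *: sq_e3 K.

(** The last two rows of the action table list the products e3 b and b u, for b
    in the basis 1, e1, e2, e3 and u = g nu . 1. *)
Lemma sw_act_two_sided (K : fieldType) (l1 l2 l3 l4 : K) :
  two_sided_action (sq_e3 K) (gnu_act_one l1 l2 l3 l4) (sw_act l1 l2 l3 l4).
Proof.
move=> a; set u := gnu_act_one _ _ _ _.
have rowE (i : 'I_4) (w : split_quaternion K) :
    lin_ext (nth [::] (sw_act_table l1 l2 l3 l4) i) a = w ->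
    sw_act l1 l2 l3 l4 (delta_mx 0 i) a = w.
  move=> <-; rewrite /sw_act [LHS](linear_coord (f := bilin_ext _ _)).
    by apply: eq_bigr => j _; rewrite bilin_ext_delta.
  by move=> c x y; rewrite linearPr.
have -> : 1 = sw_one K by [].
rewrite /sw_one /sw_g /sw_nu /sw_gnu !vec4_delta.
split; apply: rowE; rewrite /lin_ext sum4E /= ?scaler0 ?addr0 //;
  have -> : 1 = sq_one K by [].
- by apply/rowP; apply: ord4P; rewrite !mxE /=; ring.
- by rewrite [RHS]sq_mulE /= !inord4E; apply/rowP; apply: ord4P;
    rewrite !mxE /=; ring.
- rewrite [RHS]sq_mulE /= !inord4E /u /gnu_act_one; have -> : 1 = sq_one K by [].
  by apply/rowP; apply: ord4P; rewrite !mxE /=; ring.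
Qed.

Lemma sw_omega_two_sided (K : fieldType) (l1 l2 l3 l4 : K) :
  two_sided_cocycle (sq_e3 K) (gnu_act_one l1 l2 l3 l4) (sw_omega l1 l2 l3 l4).
Proof.
move=> h l; rewrite sq_mul_basis.
have -> // : sq_e3 K * gnu_act_one l1 l2 l3 l4 =
  l4 *: 1 + l3 *: sq_e1 K - l2 *: sq_e2 K + l1 *: sq_e3 K.
rewrite /gnu_act_one !mulrDr mulrN -!scalerAr !sq_mul_basis mulr1.
rewrite -[LHS]addrA [RHS]addrC [X in _ = _ + X]addrC [RHS]addrA.
by congr (_ + _); exact: addrC.
Qed.

Theorem theorem4p1 (R : realType) (l1 l2 l3 l4 : R) :
  twisted_partial_action (sw_act l1 l2 l3 l4) (sw_omega l1 l2 l3 l4).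
Proof.
exact: two_sided_twisted_partial_action (sw_act_two_sided l1 l2 l3 l4)
  (sw_omega_two_sided l1 l2 l3 l4).
Qed.
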